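(* Let $\Bbbk$ be a field, let $\Delta$ be a pure simplicial complex on $[n]$, and let $S=\Bbbk[x_1,\dots,x_n]$. Then the sequence $\{S_{2}\text{-}\mathrm{depth}(S/I_{\Delta}^{(\ell)})\}_{\ell\geq1}$ is convergent. Moreover, $$\min_{\ell\ge 1}\, S_{2}\text{-}\mathrm{depth}(S/I_{\Delta}^{(\ell)})=\lim_{\ell\rightarrow\infty}S_{2}\text{-}\mathrm{depth}(S/I_{\Delta}^{(\ell)}).$$
   Context: $\mathfrak m=(x_1,\dots,x_n)$ and $\omega_S$ is the canonical module of $S$. For an unmixed finitely generated graded $S$-module $M$ and $r\ge 2$, $S_r\text{-}\mathrm{depth}(M)=\min\{j : \dim K_M^j\ge j-r+1\}$, where $K_M^j=\mathrm{Hom}_{\Bbbk}(H^j_{\mathfrak m}(M),\Bbbk)\cong \mathrm{Ext}_S^{n-j}(M,\omega_S)$, $\dim$ is Krull dimension, and $\dim 0=-\infty$. A simplicial complex $\Delta$ on $[n]$ is a nonempty collection of subsets of $[n]$ closed under taking subsets (not every $\{i\}$ need be in $\Delta$); $\Delta$ is pure if all facets have the same cardinality. $I_\Delta\subset S$ is generated by the squarefree monomials corresponding to (minimal) non-faces of $\Delta$. For a squarefree monomial ideal $I$, the $\ell$-th symbolic power is $I^{(\ell)}=\bigcap_{P\in\mathrm{Ass}(I)}P^\ell$. *)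

(* Defs.v *)
From HB Require Import structures.
From mathcomp Require Import all_boot all_order all_algebra.
From mathcomp Require Import boolp classical_sets topology.
From mathcomp Require Import mpoly.

Set Implicit Arguments.
Unset Strict Implicit.
Unset Printing Implicit Defensive.

Import Order.TTheory GRing.Theory Num.Theory.

Local Open Scope ring_scope.

Definition simplicial_complex (n : nat) (D : {set {set 'I_n}}) : Prop :=
  D != finset.set0 /\
  (forall A B : {set 'I_n}, A \in D -> B \subset A -> B \in D).

Definition facet (n : nat) (D : {set {set 'I_n}}) (F : {set 'I_n}) : bool :=
  maxset (fun A => A \in D) F.

Definition pure (n : nat) (D : {set {set 'I_n}}) : Prop :=
  forall F G : {set 'I_n}, facet D F -> facet D G -> #|F| = #|G|.

Definition xmon (k : fieldType) (n : nat) (F : {set 'I_n}) : {mpoly k[n]} :=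
  \prod_(i in F) 'X_i.

Definition stanley_reisner (k : fieldType) (n : nat) (D : {set {set 'I_n}}) :
    set {mpoly k[n]} :=
  fun f => exists g : {set 'I_n} -> {mpoly k[n]},
    f = \sum_(A : {set 'I_n} | A \notin D) g A * xmon k A.
Arguments stanley_reisner : clear implicits.
Arguments stanley_reisner k {n} D f.

Definition prime_ideal (R : comNzRingType) (P : {pred R}) : Prop :=
  idealr_closed P /\ prime_idealr_closed P.

(* P is the annihilator of the class of f in R / J. *)
Definition associated_prime (R : comNzRingType) (J : set R) (P : {pred R}) :
    Prop :=
  prime_ideal P /\ exists f : R, forall s : R, (s \in P) <-> J (s * f).

(* The coefficients c make the power with exponent l = 0 the unit ideal. *)
Definition ideal_power (R : comNzRingType) (P : {pred R}) (l : nat) : set R :=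
  fun f => exists (m : nat) (c : 'I_m -> R) (a : 'I_m -> 'I_l -> R),
    (forall i j, a i j \in P) /\ f = \sum_(i < m) c i * \prod_(j < l) a i j.

Definition symbolic_power (R : comNzRingType) (J : set R) (l : nat) : set R :=
  fun f => forall P : {pred R}, associated_prime J P -> ideal_power P l f.

(* For a finitely generated module K over a noetherian ring R, with I the     *)
(* annihilator of K, dim K is the supremum of the lengths d of the chains     *)
(* P 0 < ... < P d of primes containing I, and - oo when there is none, i.e.  *)
(* when K = 0.  Hence "e <= dim K" is [krull_dim_geq I e], also for e < 0.    *)
Definition krull_dim_geq (R : comNzRingType) (I : set R) (e : int) : Prop :=
  exists (d : nat) (P : nat -> {pred R}),
    [/\ e <= d%:Z,
        forall i : nat, (i <= d)%N -> prime_ideal (P i),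
        forall f : R, I f -> f \in P 0%N &
        forall i : nat, (i < d)%N ->
          {subset P i <= P i.+1} /\ ~ {subset P i.+1 <= P i}].

(* The local cohomology of S / J at m = (x_1, ..., x_n) is the cohomology of  *)
(* the Cech complex C^j(S / J) = \bigoplus_(#|F| = j) (S / J)_(x_F), where    *)
(* x_F = \prod_(i in F) x_i.                                                  *)
Section LocalCohomology.
Variables (k : fieldType) (n : nat).
Local Notation S := {mpoly k[n]}.
Local Notation Q := {fraction {mpoly k[n]}}.
Local Notation "x %:F" := (@tofrac _ x).

(* Localizations are taken inside the fraction field Q of S: [localized J F]  *)
(* is J_(x_F), and (S / J)_(x_F) = S_(x_F) / J_(x_F).                         *)
Definition localized (J : set S) (F : {set 'I_n}) (u : Q) : Prop :=
  exists (s : S) (t : nat), J s /\ u = s%:F / (xmon k F)%:F ^+ t.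

Definition cech := {ffun {set 'I_n} -> Q}.

(* The direct sum of the J_(x_F), #|F| = j.  Thus C^j(S / J) is the quotient  *)
(* of [cech_degree j setT] by [cech_degree j J].                              *)
Definition cech_degree (j : nat) (J : set S) (c : cech) : Prop :=
  forall F : {set 'I_n},
    if #|F| == j then localized J F (c F) else c F = 0.

Definition cech_act (s : S) (c : cech) : cech := [ffun F => s%:F * c F].

Definition cech_diff (c : cech) : cech :=
  [ffun F : {set 'I_n} =>
     \sum_(i in F) (-1) ^+ #|[set h in F | (h < i)%N]%SET|
                     * c (F :\ i)%SET].

(* H^j_m(S / J) is the quotient of [cocycle J j] by [coboundary J j]; both    *)
(* are made of lifts to S_(x_F) of the cochains of S / J.                     *)
Definition cocycle (J : set S) (j : nat) (z : cech) : Prop :=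
  cech_degree j setT z /\ cech_degree j.+1 J (cech_diff z).

Definition coboundary (J : set S) (j : nat) (z : cech) : Prop :=
  exists b : cech,
    (if j is j'.+1 then cech_degree j' setT b else b = 0) /\
    cech_degree j J (z - cech_diff b).

(* Homogeneous of degree d for the standard Z-grading: s / x_F^t has degree   *)
(* deg s - t * #|F|.                                                          *)
Definition cech_homog (d : int) (c : cech) : Prop :=
  forall F : {set 'I_n}, c F = 0 \/ exists (e t : nat) (s : S),
    [/\ s \is e.-homog, c F = s%:F / (xmon k F)%:F ^+ t
      & e%:Z = d + (t * #|F|)%N%:Z].

(* The elements of K^j are the k-linear functionals on H^j_m(S / J) that      *)
(* vanish on all but finitely many graded components, i.e. the graded         *)
(* Hom_k(H^j_m(S / J), k).  Only the values of phi on cocycles matter.        *)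
Definition dual_local_cohomology (J : set S) (j : nat) (phi : cech -> k) :
    Prop :=
  [/\ forall (a : k) (z z' : cech), cocycle J j z -> cocycle J j z' ->
        phi (cech_act a%:MP z + z') = a * phi z + phi z',
      forall z : cech, coboundary J j z -> phi z = 0 &
      exists N : int, forall (d : int) (z : cech),
        N < `|d| -> cocycle J j z -> cech_homog d z -> phi z = 0].

(* S acts on K^j by (s phi)(z) = phi (s z). *)
Definition ann_dual (J : set S) (j : nat) : set S :=
  fun s => forall phi : cech -> k, dual_local_cohomology J j phi ->
    forall z : cech, cocycle J j z -> phi (cech_act s z) = 0.

Definition S_depth_set (r : nat) (J : set S) (j : nat) : Prop :=
  krull_dim_geq (ann_dual J j) (j%:Z - r%:Z + 1).

(* The S_r-depth of S / J.  For a proper homogeneous ideal J the set is not   *)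
(* empty, since it contains dim (S / J); the value 0 is a dummy.              *)
Definition S_depth (r : nat) (J : set S) : nat :=
  match pselect (exists j, `[< S_depth_set r J j >]) with
  | left ex_j => ex_minn ex_j
  | right _ => 0%N
  end.

End LocalCohomology.

Definition is_min (A : set nat) (m : nat) : Prop :=
  A m /\ (forall a : nat, A a -> (m <= a)%N).

(* Main.v *)
From HB Require Import structures.
Require Import Defs.
From mathcomp Require Import all_boot all_order all_algebra.
From mathcomp Require Import boolp classical_sets topology.
From mathcomp Require Import mpoly.

(* Write J_l for the l-th symbolic power of I_D.  The ring endomorphism phi of
   S raising every variable to the power m has a k-linear retraction psi, which
   keeps the monomials x^(m a), sent to x^a, kills the others, and satisfies
   psi (phi s * f) = s * psi f.  Since J_l consists of the polynomials all of
   whose monomials have degree >= l off every facet, phi maps J_l to J_t and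
   psi maps J_t to J_l as soon as m (l - 1) < t <= m l.  Both maps extend to
   the Cech complexes, so that H^j(S / J_l) is a direct summand of H^j(S / J_t)
   along phi, and the annihilator of K^j for J_t contracts along phi into the
   annihilator for J_l.  As S is integral over phi(S), going-up lifts chains of
   primes and dim K^j for J_l is at most dim K^j for J_t.  Every t >= l ^ 2
   lies in ] m (l - 1), m l ] for some m, so the S_r-depth of S / J_t is at
   most that of S / J_l for all large t, which forces convergence to the
   minimum. *)

Set Implicit Arguments.
Unset Strict Implicit.
Unset Printing Implicit Defensive.

Import Order.TTheory GRing.Theory Num.Theory.

Local Open Scope ring_scope.

(** * Ideals as classical sets *)

Definition is_ideal (R : comNzRingType) (I : set R) : Prop :=
  I 0 /\ forall a u v : R, I u -> I v -> I (a * u + v).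

Lemma is_idealMl (R : comNzRingType) (I : set R) (a u : R) :
  is_ideal I -> I u -> I (a * u).
Proof. by case=> I0 IP Iu; rewrite -[_ * _]addr0; apply: IP. Qed.

Lemma is_idealD (R : comNzRingType) (I : set R) (u v : R) :
  is_ideal I -> I u -> I v -> I (u + v).
Proof. by case=> I0 IP Iu Iv; rewrite -[u]mul1r; apply: IP. Qed.

Lemma is_ideal_sum (R : comNzRingType) (I : set R) (T : Type) (r : seq T)
    (P : pred T) (F : T -> R) :
  is_ideal I -> (forall i, P i -> I (F i)) -> I (\sum_(i <- r | P i) F i).
Proof.
move=> idI IF; elim/big_ind: _ => //; first by case: idI.
by move=> u v; apply: is_idealD.
Qed.

Lemma is_ideal_adjoin (R : comNzRingType) (I : set R) (u : R) :
  is_ideal I -> is_ideal [set x | exists a b, I a /\ x = a + b * u]%classic.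
Proof.
move=> [I0 IP]; split; first by exists 0, 0; rewrite mul0r addr0.
move=> c _ _ [a [b [Ia ->]]] [a' [b' [Ia' ->]]].
exists (c * a + a'), (c * b + b'); split; first exact: IP.
by rewrite mulrDr mulrDl mulrA addrACA.
Qed.

(** * Integral extensions, going-up and Krull dimension *)

Lemma in_prime_idealX (R : comNzRingType) (p : {pred R}) (x : R) (k : nat) :
  prime_ideal p -> x ^+ k \in p -> x \in p.
Proof.
move=> [[_ p1 _] pp]; elim: k => [|k IH]; first by rewrite expr0 (negPf p1).
by rewrite exprS => /pp/orP[].
Qed.

Lemma integral_relation (A B : comNzRingType) (phi : {rmorphism A -> B})
    (y : B) : integralOver phi y ->
  exists (N : nat) (c : nat -> A),
    y ^+ N = \sum_(i < N) phi (c i) * y ^+ i.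
Proof.
case=> q mon_q /rootP; rewrite horner_coef size_map_poly_id0; last first.
  rewrite (monicP mon_q). by rewrite rmorph1 oner_neq0.
have sq : size q = (size q).-1.+1.
  by rewrite prednK // size_poly_gt0 monic_neq0.
rewrite sq big_ord_recr /= coef_map /=.
rewrite -lead_coefE (monicP mon_q) rmorph1 mul1r => /eqP.
rewrite addrC addr_eq0 => /eqP yN.
exists (size q).-1, (fun i => - q`_i).
by rewrite yN -sumrN; apply: eq_bigr => i _; rewrite coef_map /= rmorphN mulNr.
Qed.

(* A prime of B containing I and maximal among the ideals contracting into p
   must contract onto p, by an integral equation. *)
Lemma going_up (A B : comNzRingType) (phi : {rmorphism A -> B})
    (int_phi : integralRange phi) (p : {pred A}) (I : set B) :
    prime_ideal p -> is_ideal I -> (forall s, I (phi s) -> s \in p) ->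
  exists P : {pred B},
    [/\ prime_ideal P, forall f, I f -> f \in P
      & forall s, (phi s \in P) = (s \in p)].
Proof.
move=> prp idI Ip; have [[p0 p1 pD] pM] := prp.
pose good (X : set B) :=
  [/\ is_ideal X, (I `<=` X)%classic & forall s, X (phi s) -> s \in p].
have [|X [XG Xmax]] :=
    @Zorn_bigcup B (fun X => X = classical_sets.set0 \/ good X).
  move=> F FG Ftot.
  have [[Y [FY gY]]|noY] := pselect (exists Y, F Y /\ good Y); last first.
    left; apply/seteqP; split=> // x [Y FY Yx].
    have [Y0|gY] := FG _ FY; first by move: Yx; rewrite Y0.
    by case: noY; exists Y.
  right; split.
  - split; first by exists Y => //; case: gY => [[]].
    move=> a u v [U FU Uu] [V FV Vv].
    have [UV|VU] := Ftot _ _ FU FV.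
      have [V0|[idV _ _]] := FG _ FV; first by move: Vv; rewrite V0.
      by exists V => //; case: idV => _; apply=> //; apply: UV.
    have [U0|[idU _ _]] := FG _ FU; first by move: Uu; rewrite U0.
    by exists U => //; case: idU => _; apply=> //; apply: VU.
  - by move=> x Ix; exists Y => //; case: gY => _ + _; apply.
  - move=> s [U FU Us].
    have [U0|[_ _]] := FG _ FU; first by move: Us; rewrite U0.
    exact.
have gX : good X.
  (* The empty set is not maximal: [I] is good and contains 0. *)
  case: XG => // X0; case: (Xmax I); last by right; split.
  by split; [rewrite X0 => x | move=> /(_ 0); rewrite X0; apply; case: idI].
have [idX IX Xp] := gX; have [X0 XP] := idX.
(* Maximality in terms of elements: the ideal generated by [X] and an element [u] outside [X] no
   longer contracts into [p]. *)
have adj u : ~ X u -> exists a b s, [/\ X a, s \notin p & phi s = a + b * u].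
  move=> nXu.
  apply: contrapT => nex.
  apply: (Xmax [set x | exists a b, X a /\ x = a + b * u]%classic).
    split; first by move=> x Xx; exists x, 0; rewrite mul0r addr0.
    by move=> /(_ u) h; apply/nXu/h; exists 0, 1; rewrite mul1r add0r.
  right; split; first exact: is_ideal_adjoin.
    by move=> x /IX Xx; exists x, 0; rewrite mul0r addr0.
  move=> s [a [b [Xa e]]]; apply: contrapT => /negP sp; apply: nex.
  by exists a, b, s.
pose P : {pred B} := fun x => `[< X x >].
have PE x : (x \in P) = `[< X x >] by [].
exists P; split.
- split; first split.
  + exact/asboolP.
  + apply/asboolP => X1; move/negP: p1; apply; apply: Xp.
    by rewrite rmorph1.
  + by move=> a u v /asboolP Xu /asboolP Xv; apply/asboolP; apply: XP.
  move=> u v /asboolP Xuv; rewrite !PE; apply: contrapT => /negP.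
  rewrite negb_or => /andP[/asboolPn nu /asboolPn nv].
  have [a [b [s [Xa sp es]]]] := adj _ nu.
  have [a' [b' [s' [Xa' sp' es']]]] := adj _ nv.
  have : s * s' \in p.
    apply: Xp; rewrite rmorphM es es' mulrDl; apply: is_idealD => //.
      by rewrite mulrC; apply: is_idealMl.
    rewrite mulrDr; apply: is_idealD => //; first exact: is_idealMl.
    by rewrite mulrACA; apply: is_idealMl.
  by move=> /pM; rewrite (negPf sp) (negPf sp').
- by move=> f /IX Xf; apply/asboolP.
move=> u; apply/idP/idP => [/asboolP/Xp //|up].
apply/asboolP; apply: contrapT => nXu.
have [a [y [v [Xa vp ev]]]] := adj _ nXu.
have [N [c yN]] := integral_relation (int_phi y).
(* modulo X, phi v = y * phi u, so the equation of y multiplied by (phi u)^N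
   lies in the image of phi *)
pose w := \sum_(i < N) c i * v ^+ i * u ^+ (N - i).
have congr i : X (phi v ^+ i - (y * phi u) ^+ i).
  rewrite subrXX mulrC; apply: is_idealMl => //.
  by rewrite ev addrK.
have : v ^+ N - w \in p.
  apply: Xp; rewrite rmorphB rmorphXn rmorph_sum /=.
  rewrite -[phi v ^+ N](subrK ((y * phi u) ^+ N)) -addrA.
  apply: is_idealD => //.
  rewrite exprMn yN mulr_suml -sumrB; apply: is_ideal_sum => // i _.
  rewrite !rmorphM !rmorphXn /=.
  have -> : phi u ^+ N = phi u ^+ (N - i) * phi u ^+ i.
    by rewrite -exprD subnK // ltnW.
  rewrite (_ : _ - _ = - (phi (c i) * phi u ^+ (N - i)) *
     (phi v ^+ i - (y * phi u) ^+ i)); first exact: is_idealMl.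
  rewrite exprMn mulNr mulrBr opprB; congr (_ - _).
    by rewrite -!mulrA; congr (_ * _); rewrite mulrCA.
  by rewrite mulrAC.
(* Every term of [w] has a factor [u], as [i < N], so [w] lies in [p]; then so does [v], against the
   choice of [v]. *)
move=> vw; have : v ^+ N \in p.
  rewrite -(subrK w (v ^+ N)) -[_ - w]mul1r; apply: (pD) => //.
  apply: (big_ind (fun x => x \in p)) => //.
    by move=> x x' px px'; rewrite -[x]mul1r; apply: (pD).
  move=> i _.
  have -> : (N - i)%N = (N - i).-1.+1 by rewrite prednK // subn_gt0.
  by rewrite exprSr mulrA -[X in X \in p]addr0; apply: (pD).
by move=> /(in_prime_idealX prp); rewrite (negPf vp).
Qed.

(** Going-up lifts a chain one prime at a time, first over [J] and then over the prime just built.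
    Inclusions stay strict because the lifted primes contract to the distinct primes of the given
    chain. *)
Lemma krull_dim_geq_integral (A B : comNzRingType) (phi : {rmorphism A -> B})
    (I : set A) (J : set B) (e : int) :
    integralRange phi -> is_ideal J -> (forall s, J (phi s) -> I s) ->
  krull_dim_geq I e -> krull_dim_geq J e.
Proof.
move=> int_phi idJ JI [d [p [ed prp Ip chain]]].
pose lifts (X : set B) (i : nat) (P : {pred B}) :=
  [/\ prime_ideal P, forall f, X f -> f \in P
    & forall s, (phi s \in P) = (s \in p i)].
have [P0 P0P] : exists P, lifts J 0%N P.
  by apply: going_up => //; [apply: prp | move=> s /JI/Ip].
(* The hypotheses stand under the existential so that a next prime can be chosen for all [P] and
   [i], which makes the recursion below total. *)
have step (P : {pred B}) i : exists P', (i < d)%N ->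
    lifts J i P -> lifts [set x | x \in P]%classic i.+1 P'.
  have [[id [prP JP PE]]|no] := pselect ((i < d)%N /\ lifts J i P); last first.
    by exists P => id Pi; case: no.
  have [|s /=|P' P'P] := going_up int_phi (prp i.+1 id)
    (I := [set x | x \in P]%classic).
  - by case: prP => [[P00 P1 PD] _]; split => //= a u v; apply: PD.
  - by rewrite PE; case: (chain _ id) => + _; apply.
  by exists P'.
pose P := fix P i := if i is i'.+1 then projT1 (cid (step (P i') i')) else P0.
have PS i : (i < d)%N -> lifts J i (P i) ->
    lifts [set x | x \in P i]%classic i.+1 (P i.+1).
  by rewrite /=; case: cid.
have PP i : (i <= d)%N -> lifts J i (P i).
  elim: i => [|i IH] id //; have := IH (ltnW id) => Pi.
  have [prP sP eP] := PS _ id Pi; split=> // f Jf; apply: sP => /=.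
  by case: Pi => _ + _; apply.
exists d, P; split => //.
- by move=> i /PP[].
- by move=> f Jf; have [_ + _] := PP 0%N isT; apply.
move=> i id; have [_ sub eS] := PS _ id (PP _ (ltnW id)).
have [_ _ e0] := PP _ (ltnW id).
split=> [x|sub']; first exact: sub.
have [_] := chain _ id; apply => s; rewrite -eS -e0; exact: sub'.
Qed.

(** * The endomorphism raising variables to the power m, and its retraction *)

Section VeroneseSplitting.
Variables (k : fieldType) (n : nat).
Local Notation S := {mpoly k[n]}.
Local Notation Q := {fraction {mpoly k[n]}}.
Local Notation "x %:F" := (@tofrac _ x).

Definition mdvd (m : nat) (a : 'X_{1..n}) : bool := [forall i, m %| a i]%N.

Definition mdiv (m : nat) (a : 'X_{1..n}) : 'X_{1..n} :=
  [multinom (a i %/ m)%N | i < n].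

Lemma mdvd_muln m a : mdvd m (a *+ m)%MM.
Proof. by apply/forallP => i; rewrite mulmnE dvdn_mull. Qed.

Lemma mdivK m a : mdvd m a -> (mdiv m a *+ m)%MM = a.
Proof. by move=> /forallP h; apply/mnmP => i; rewrite mulmnE mnmE divnK. Qed.

Lemma mulnK_mdiv m a : (0 < m)%N -> mdiv m (a *+ m)%MM = a.
Proof. by move=> m0; apply/mnmP => i; rewrite mnmE mulmnE mulnK. Qed.

(** The endomorphism phi of the overview. *)
Definition inflate (m : nat) (f : S) : S := f \mPo [tuple 'X_i ^+ m | i < n].

HB.instance Definition _ m := GRing.RMorphism.copy (inflate m)
  (comp_mpoly [tuple ('X_i : S) ^+ m | i < n]).

Lemma inflateX m a : inflate m 'X_[a] = 'X_[(a *+ m)%MM].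
Proof.
rewrite /inflate comp_mpolyX [RHS]mpolyXE_id; apply: eq_bigr => i _.
by rewrite tnth_mktuple mulmnE -exprM mulnC.
Qed.

Lemma inflateC m c : inflate m c%:MP = c%:MP.
Proof. exact: comp_mpolyC. Qed.

Lemma inflate_xmon m (F : {set 'I_n}) : inflate m (xmon k F) = xmon k F ^+ m.
Proof.
rewrite /xmon rmorph_prod -prodrXl; apply: eq_bigr => i _.
by rewrite /= inflateX mpolyXn.
Qed.

(** The retraction psi of the overview; [mcoeff_deflate] describes it by coefficients, and its
    properties are derived from that description. *)
Definition deflate (m : nat) (f : S) : S :=
  \sum_(a <- msupp f) (if mdvd m a then f@_a *: 'X_[mdiv m a] else 0).

Lemma mcoeffMXE (f : S) (a b : 'X_{1..n}) :
  (f * 'X_[a])@_b = if (a <= b)%MM then f@_(b - a) else 0.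
Proof.
case: ifPn => [ab|nab]; first by rewrite -{1}(submK ab) addmC mcoeffMX.
apply: memN_msupp_eq0; rewrite (perm_mem (msuppMX _ _)).
by apply: contra nab => /mapP[c _ ->]; exact: lem_addr.
Qed.

Lemma mcoeff_deflate m f b : (0 < m)%N -> (deflate m f)@_b = f@_(b *+ m)%MM.
Proof.
move=> m0; rewrite /deflate raddf_sum /= [f in RHS]mpolyE raddf_sum /=.
apply: eq_bigr => a _; rewrite mcoeffZ mcoeffX.
case: ifPn => [ma|]; last first.
  rewrite mcoeff0; case: eqP => [->|]; last by rewrite mulr0.
  by rewrite mdvd_muln.
rewrite mcoeffZ mcoeffX; congr (_ * (_ : bool)%:R).
by apply/eqP/eqP => [<-|e]; [rewrite mdivK | rewrite e mulnK_mdiv].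
Qed.

Lemma deflateD m f g : (0 < m)%N ->
  deflate m (f + g) = deflate m f + deflate m g.
Proof.
by move=> m0; apply/mpolyP => b; rewrite !(mcoeffD, mcoeff_deflate).
Qed.

Lemma deflate0 m : (0 < m)%N -> deflate m 0 = 0.
Proof.
by move=> m0; apply/mpolyP => b; rewrite mcoeff_deflate // !mcoeff0.
Qed.

Lemma deflate1 m : (0 < m)%N -> deflate m 1 = 1.
Proof.
move=> m0; apply/mpolyP => b; rewrite mcoeff_deflate // !mcoeff1.
congr (_ : bool)%:R; apply/eqP/eqP => [e|->].
  rewrite -[b](@mulnK_mdiv m) // e; apply/mnmP => i.
  by rewrite mnmE mnm0E div0n.
by apply/mnmP => i; rewrite mulmnE mnm0E.
Qed.

(** Linearity over phi. By additivity [s] may be a term in x^a; the coefficients at b of both sides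
    then read [f] at m (b - a), because m a divides m b exactly when a divides b. *)
Lemma deflate_inflateM m (s f : S) : (0 < m)%N ->
  deflate m (inflate m s * f) = s * deflate m f.
Proof.
move=> m0; elim/mpolyind: s => [|c a p _ _ IH].
  by rewrite rmorph0 !mul0r deflate0.
rewrite rmorphD !mulrDl deflateD // IH; congr (_ + _).
rewrite -mul_mpolyC rmorphM /= inflateC inflateX.
apply/mpolyP => b; rewrite mcoeff_deflate // -!mulrA !mcoeffCM; congr (_ * _).
rewrite (mulrC _ f) (mulrC _ (deflate m f)) !mcoeffMXE mcoeff_deflate //.
have -> : (a *+ m <= b *+ m)%MM = (a <= b)%MM.
  apply/mnm_lepP/mnm_lepP => h i; move: (h i);
    by rewrite !mulmnE leq_pmul2r.
case: ifP => // _; congr (f@_ _); apply/mnmP => i.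
by rewrite !(mnmBE, mulmnE) mulnBl.
Qed.

Lemma inflateK m : (0 < m)%N -> cancel (inflate m) (deflate m).
Proof.
move=> m0 f.
by rewrite -[inflate m f]mulr1 deflate_inflateM // deflate1 // mulr1.
Qed.

Lemma msupp_inflate m f a : (0 < m)%N ->
  a \in msupp (inflate m f) -> exists2 b, b \in msupp f & a = (b *+ m)%MM.
Proof.
move=> m0; rewrite [f in inflate _ f]mpolyE rmorph_sum /= mcoeff_msupp.
rewrite raddf_sum /=; apply: contraPP => nex; rewrite big1_seq ?eqxx // => b bf.
rewrite -mul_mpolyC rmorphM /= inflateC inflateX mcoeffCM mcoeffX.
by case: eqP => [e|]; [case: nex; exists b | rewrite mulr0].
Qed.

(** Constants are in the image, and the variable x_i is a root of X^m - phi(x_i); sums and products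
    of integral elements are integral. *)
Lemma inflate_integral m : (0 < m)%N -> integralRange (@inflate m).
Proof.
move=> m0 f; elim/mpolyind: f => [|c a p _ _ IH]; first exact: integral0.
apply: integral_add => //; rewrite -mul_mpolyC -(inflateC m).
apply: integral_mul; first exact: integral_id.
rewrite mpolyXE_id; apply: (big_ind (integralOver (@inflate m))).
- exact: integral1.
- by move=> x y; apply: integral_mul.
move=> i _; elim: (a i) => [|j IHj]; first exact: integral1.
rewrite exprS; apply: integral_mul => //.
exists ('X^m - ('X_i)%:P); first by rewrite monicXnsubC.
rewrite rmorphB /= map_polyXn map_polyC /= /root.
rewrite hornerD hornerN hornerXn hornerC.
by rewrite inflateX mpolyXn subrr.
Qed.

End VeroneseSplitting.

(** * Functions on a fraction field given on representatives *)

Section FractionExtension.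
Variables (R : idomainType) (T W : Type) (w0 : W).
Variables (tau : T -> R) (v : R -> T -> W).
Local Notation "x %:F" := (@tofrac _ x).

(* The function sending a / tau c to v a c, and w0 outside these fractions. *)
Definition frac_ext (u : {fraction R}) : W :=
  if pselect (exists ac : R * T,
      tau ac.2 != 0 /\ u = ac.1%:F / (tau ac.2)%:F) is left e
  then v (projT1 (cid e)).1 (projT1 (cid e)).2 else w0.

Lemma frac_extE (a : R) (c : T) :
    (forall a c a' c', tau c != 0 -> tau c' != 0 ->
       a * tau c' = a' * tau c -> v a c = v a' c') ->
  tau c != 0 -> frac_ext (a%:F / (tau c)%:F) = v a c.
Proof.
move=> wd c0; rewrite /frac_ext; case: pselect => [e|[]]; last by exists (a, c).
case: (cid e) => -[a' c'] /= [c'0 eq]; apply: wd => //.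
move/eqP: eq; rewrite eqr_div ?tofrac_eq0 // -!tofracM tofrac_eq.
by move=> /eqP ->.
Qed.

End FractionExtension.

Section Fractions.
Variable (R : idomainType).
Local Notation "x %:F" := (@tofrac _ x).

Lemma fraction_div (u : {fraction R}) :
  exists a b : R, b != 0 /\ u = a%:F / b%:F.
Proof.
elim/quotW: u => x; exists \n_x, \d_x; split; first exact: denom_ratioP.
have dx := denom_ratioP x.
apply: (canRL (mulfK _)); first by rewrite tofrac_eq0.
rewrite !piE; apply/eqmodP => /=.
rewrite FracField.equivfE.
by rewrite /FracField.mulf !numden_Ratio ?mulf_neq0 ?oner_neq0 // !mulr1 mulrC.
Qed.

End Fractions.

(** The constant coefficient of an integral equation of [b] maps to a multiple of [b]. If it
    vanishes, one factor X is cancelled, since [b] is not a zero divisor; the induction keeps only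
    that the polynomial is nonzero. *)
Lemma integral_divisor (A B : idomainType) (phi : {rmorphism A -> B}) (b : B) :
  integralOver phi b -> b != 0 -> exists c d, c != 0 /\ phi c = b * d.
Proof.
move=> [p mp rp] b0; move: (monic_neq0 mp) rp => {mp}.
elim/poly_ind: p => [|q c IH]; first by rewrite eqxx.
move=> p0; rewrite rmorphD rmorphM /= map_polyX map_polyC /= => /rootP.
rewrite hornerMXaddC.
have [c0|c0 e] := eqVneq c 0.
  rewrite c0 rmorph0 addr0 => /eqP; rewrite mulf_eq0 (negPf b0) orbF => qb.
  apply: IH => //; apply: contraNneq p0 => ->.
  by rewrite c0 mul0r add0r.
exists c, (- (map_poly phi q).[b]); split => //.
by rewrite mulrN mulrC; apply/eqP; rewrite -addr_eq0 addrC e.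
Qed.

(** * Extension of phi and psi to the fraction field *)

Section CechSplitting.
Variables (k : fieldType) (n m : nat).
Hypothesis m_gt0 : (0 < m)%N.
Local Notation S := {mpoly k[n]}.
Local Notation Q := {fraction {mpoly k[n]}}.
Local Notation "x %:F" := (@tofrac _ x).
Local Notation phi := (@inflate k n m).
Local Notation psi := (@deflate k n m).

Lemma inflate_eq0 (c : S) : (phi c == 0) = (c == 0).
Proof.
by rewrite -[0 in LHS](rmorph0 phi) (inj_eq (can_inj (inflateK m_gt0))).
Qed.

(** By integrality denominators can be moved into the image of phi. Hence psi extends to all
    fractions by sending a / phi(b) to psi(a) / b, which is well defined by [deflate_inflateM]. *)
Lemma fraction_div_inflate (u : Q) :
  exists a b : S, b != 0 /\ u = a%:F / (phi b)%:F.
Proof.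
have [a [b [b0 ->]]] := fraction_div u.
have [c [d [c0 e]]] := integral_divisor (inflate_integral m_gt0 b) b0.
exists (a * d), c; split => //.
have d0 : d != 0.
  by apply: contraNneq c0 => d0; rewrite -inflate_eq0 e d0 mulr0.
by rewrite e !tofracM -mulf_div divff ?mulr1 // tofrac_eq0.
Qed.

Definition frac_inflate : Q -> Q :=
  frac_ext 0 id (fun a c : S => (phi a)%:F / (phi c)%:F).

Definition frac_deflate : Q -> Q :=
  frac_ext 0 phi (fun a c : S => (psi a)%:F / c%:F).

Lemma frac_inflateE (a c : S) :
  c != 0 -> frac_inflate (a%:F / c%:F) = (phi a)%:F / (phi c)%:F.
Proof.
move=> c0; apply: (@frac_extE S S Q 0 id) => // {}a {}c a' c' {}c0 c'0 e.
apply/eqP; rewrite eqr_div ?tofrac_eq0 ?inflate_eq0 // -!tofracM -!rmorphM.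
by rewrite e.
Qed.

Lemma frac_deflateE (a c : S) :
  c != 0 -> frac_deflate (a%:F / (phi c)%:F) = (psi a)%:F / c%:F.
Proof.
move=> c0; rewrite /frac_deflate frac_extE ?inflate_eq0 // => {c0}{}a {}c a' c'.
rewrite !inflate_eq0 => c0 c'0 e.
apply/eqP; rewrite eqr_div ?tofrac_eq0 // -!tofracM tofrac_eq.
by rewrite mulrC -deflate_inflateM // mulrC e mulrC deflate_inflateM // mulrC.
Qed.

Lemma frac_inflateD : {morph frac_inflate : u v / u + v}.
Proof.
move=> u v; have [a [b [b0 ->]]] := fraction_div u.
have [c [d [d0 ->]]] := fraction_div v.
rewrite addf_div ?tofrac_eq0 // -!tofracM -!tofracD.
rewrite !frac_inflateE ?mulf_neq0 //.
rewrite addf_div ?tofrac_eq0 ?inflate_eq0 // -!tofracM -!tofracD.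
by rewrite rmorphD !rmorphM.
Qed.

Lemma frac_deflateD : {morph frac_deflate : u v / u + v}.
Proof.
move=> u v; have [a [b [b0 ->]]] := fraction_div_inflate u.
have [c [d [d0 ->]]] := fraction_div_inflate v.
rewrite addf_div ?tofrac_eq0 ?inflate_eq0 // -!tofracM -!tofracD -rmorphM.
rewrite !frac_deflateE ?mulf_neq0 //.
rewrite addf_div ?tofrac_eq0 // -!tofracM -!tofracD deflateD //.
by rewrite ![_ * phi _]mulrC !deflate_inflateM // ![_ * psi _]mulrC.
Qed.

Lemma frac_deflateM (s : S) (u : Q) :
  frac_deflate ((phi s)%:F * u) = s%:F * frac_deflate u.
Proof.
have [a [b [b0 ->]]] := fraction_div_inflate u.
by rewrite mulrA -tofracM !frac_deflateE // deflate_inflateM // tofracM mulrA.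
Qed.

Lemma frac_inflateK : cancel frac_inflate frac_deflate.
Proof.
move=> u; have [a [b [b0 ->]]] := fraction_div u.
by rewrite frac_inflateE // frac_deflateE // inflateK.
Qed.

Lemma frac_inflate_is_zmod_morphism : zmod_morphism frac_inflate.
Proof.
by move=> u v; apply/eqP; rewrite eq_sym subr_eq -frac_inflateD subrK.
Qed.

Lemma frac_deflate_is_zmod_morphism : zmod_morphism frac_deflate.
Proof.
by move=> u v; apply/eqP; rewrite eq_sym subr_eq -frac_deflateD subrK.
Qed.

HB.instance Definition _ :=
  GRing.isZmodMorphism.Build Q Q frac_inflate frac_inflate_is_zmod_morphism.

HB.instance Definition _ :=
  GRing.isZmodMorphism.Build Q Q frac_deflate frac_deflate_is_zmod_morphism.
End CechSplitting.

(** * The action of S on the Cech complex and on its dual cohomology *)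

Section CechComplex.
Variables (k : fieldType) (n : nat).
Local Notation S := {mpoly k[n]}.
Local Notation Q := {fraction {mpoly k[n]}}.
Local Notation "x %:F" := (@tofrac _ x).
Local Notation cech := (cech k n).
Implicit Types (J : set S) (F : {set 'I_n}) (z : cech).

Lemma xmonE F : xmon k F = 'X_[[multinom (i \in F : nat) | i < n]].
Proof.
rewrite mpolyXE_id /xmon big_mkcond; apply: eq_bigr => i _.
by rewrite mnmE; case: ifP.
Qed.

Lemma xmon_neq0 F : xmon k F != 0.
Proof. by apply/prodf_neq0 => i _; rewrite -msupp_eq0 msuppX. Qed.

Lemma xmonF_neq0 F (t : nat) : (xmon k F)%:F ^+ t != 0.
Proof. by rewrite expf_neq0 // tofrac_eq0 xmon_neq0. Qed.

Lemma is_ideal_setT : is_ideal ([set: S]%classic).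
Proof. by []. Qed.

Lemma localized0 J F : is_ideal J -> localized J F 0.
Proof. by case=> J0 _; exists 0, 0%N; rewrite tofrac0 mul0r. Qed.

Lemma localizedMl J F s u :
  is_ideal J -> localized J F u -> localized J F (s%:F * u).
Proof.
move=> idJ [a [t [Ja ->]]]; exists (s * a), t; split; first exact: is_idealMl.
by rewrite tofracM mulrA.
Qed.

Lemma cech_actE s z F : cech_act s z F = s%:F * z F.
Proof. by rewrite ffunE. Qed.

Lemma cech_act_diff s z : cech_diff (cech_act s z) = cech_act s (cech_diff z).
Proof.
apply/ffunP => F; rewrite !ffunE mulr_sumr; apply: eq_bigr => i _.
by rewrite cech_actE mulrCA.
Qed.

Lemma cech_degree_act J j s z :
  is_ideal J -> cech_degree j J z -> cech_degree j J (cech_act s z).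
Proof.
move=> idJ zJ F; move: (zJ F); rewrite cech_actE; case: ifP => _.
  exact: localizedMl.
by move=> ->; rewrite mulr0.
Qed.

Lemma cech_degree0 J j : is_ideal J -> cech_degree j J 0.
Proof.
by move=> idJ F; rewrite ffunE; case: ifP => // _; apply: localized0.
Qed.

Lemma cech_diff0 : cech_diff (0 : cech) = 0.
Proof.
apply/ffunP => F; rewrite !ffunE big1 // => i _.
by rewrite ffunE mulr0.
Qed.

Lemma cocycle_act J j s z :
  is_ideal J -> cocycle J j z -> cocycle J j (cech_act s z).
Proof.
move=> idJ [zS zJ]; split; first exact: cech_degree_act is_ideal_setT zS.
by rewrite cech_act_diff; apply: cech_degree_act.
Qed.

Lemma coboundary0 J j : is_ideal J -> coboundary J j 0.
Proof.
move=> idJ; exists 0; rewrite cech_diff0 subr0; split; last exact: cech_degree0.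
by case: j => // j; apply: cech_degree0 is_ideal_setT.
Qed.

Lemma is_ideal_ann_dual J j : is_ideal J -> is_ideal (ann_dual J j).
Proof.
move=> idJ; split.
  move=> f [_ fB _] z zJ; rewrite (_ : cech_act 0 z = 0).
    by rewrite fB //; apply: coboundary0.
  by apply/ffunP => F; rewrite cech_actE ffunE tofrac0 mul0r.
move=> a u v au av f df z zJ; have [fD _ _] := df.
(* The factor [1%:MP] gives the sum the shape of the linearity condition, and [a] acts first so that
   [u] is applied to a cocycle. *)
rewrite (_ : cech_act (a * u + v) z =
  cech_act 1%:MP (cech_act u (cech_act a z)) + cech_act v z); last first.
  apply/ffunP => F; rewrite [RHS]ffunE !cech_actE tofrac1 mul1r mulrA -tofracM.
  by rewrite -mulrDl -tofracD [u * a]mulrC.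
rewrite fD; try by do !apply: cocycle_act.
by rewrite au ?av ?mulr0 ?addr0 //; apply: cocycle_act.
Qed.

End CechComplex.

(** * The splitting of local cohomology along phi *)

Section CechSplittingComplex.
Variables (k : fieldType) (n m : nat).
Hypothesis m_gt0 : (0 < m)%N.
Local Notation S := {mpoly k[n]}.
Local Notation Q := {fraction {mpoly k[n]}}.
Local Notation "x %:F" := (@tofrac _ x).
Local Notation phi := (@inflate k n m).
Local Notation psi := (@deflate k n m).
Local Notation cech := (cech k n).
Local Notation Phi := (@frac_inflate k n m).
Local Notation Psi := (@frac_deflate k n m).

Definition cech_inflate (z : cech) : cech := [ffun F => Phi (z F)].
Definition cech_deflate (z : cech) : cech := [ffun F => Psi (z F)].

Lemma frac_inflate_localized (J J' : set S) F u :
    (forall f, J f -> J' (phi f)) ->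
  localized J F u -> localized J' F (Phi u).
Proof.
move=> JJ' [s [t [Js ->]]]; exists (phi s), (m * t)%N; split; first exact: JJ'.
rewrite -tofracXn frac_inflateE ?expf_neq0 ?xmon_neq0 //.
by rewrite rmorphXn /= inflate_xmon -exprM tofracXn.
Qed.

(** Multiplying through by x_F^(t (m - 1)) turns the denominator into x_F^(t m) = phi(x_F^t), to
    which psi applies. *)
Lemma localized_frac_deflateE F s (t : nat) :
  Psi (s%:F / (xmon k F)%:F ^+ t) =
  (psi (s * xmon k F ^+ (t * m.-1)))%:F / (xmon k F)%:F ^+ t.
Proof.
rewrite -tofracXn -frac_deflateE ?expf_neq0 ?xmon_neq0 //; congr Psi.
rewrite (rmorphXn phi) /= inflate_xmon -exprM.
apply/eqP; rewrite eqr_div ?tofrac_eq0 ?expf_neq0 ?xmon_neq0 //.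
rewrite -!tofracM -mulrA -exprD; apply/eqP; congr (_ * _ ^+ _)%:F.
by rewrite -mulnSr prednK // mulnC.
Qed.

Lemma frac_deflate_localized (J J' : set S) F u :
    is_ideal J' -> (forall f, J' f -> J (psi f)) ->
  localized J' F u -> localized J F (Psi u).
Proof.
move=> idJ' JJ' [s [t [Js ->]]]; rewrite localized_frac_deflateE.
exists (psi (s * xmon k F ^+ (t * m.-1))), t; split => //.
by apply: JJ'; rewrite mulrC; apply: is_idealMl.
Qed.

Lemma cech_inflate_degree (J J' : set S) j z :
    (forall f, J f -> J' (phi f)) ->
  cech_degree j J z -> cech_degree j J' (cech_inflate z).
Proof.
move=> JJ' zJ F; move: (zJ F); rewrite ffunE; case: ifP => _.
  exact: frac_inflate_localized.
by move=> ->; rewrite raddf0.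
Qed.

Lemma cech_deflate_degree (J J' : set S) j z :
    is_ideal J' -> (forall f, J' f -> J (psi f)) ->
  cech_degree j J' z -> cech_degree j J (cech_deflate z).
Proof.
move=> idJ' JJ' zJ F; move: (zJ F); rewrite ffunE; case: ifP => _.
  exact: frac_deflate_localized.
by move=> ->; rewrite raddf0.
Qed.

Lemma cech_inflate_diff z :
  cech_inflate (cech_diff z) = cech_diff (cech_inflate z).
Proof.
apply/ffunP => F; rewrite !ffunE raddf_sum; apply: eq_bigr => i _.
by rewrite raddfMsign ffunE.
Qed.

Lemma cech_deflate_diff z :
  cech_deflate (cech_diff z) = cech_diff (cech_deflate z).
Proof.
apply/ffunP => F; rewrite !ffunE raddf_sum; apply: eq_bigr => i _.
by rewrite raddfMsign ffunE.
Qed.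

Lemma cech_deflateD z z' :
  cech_deflate (z + z') = cech_deflate z + cech_deflate z'.
Proof. by apply/ffunP => F; rewrite !ffunE raddfD. Qed.

Lemma cech_deflateB z z' :
  cech_deflate (z - z') = cech_deflate z - cech_deflate z'.
Proof. by apply/ffunP => F; rewrite !ffunE raddfB. Qed.

Lemma cech_deflate0 : cech_deflate 0 = 0.
Proof. by apply/ffunP => F; rewrite !ffunE raddf0. Qed.

Lemma cech_deflate_act s z :
  cech_deflate (cech_act (phi s) z) = cech_act s (cech_deflate z).
Proof. by apply/ffunP => F; rewrite !ffunE frac_deflateM. Qed.

Lemma cech_inflateK : cancel cech_inflate cech_deflate.
Proof. by move=> z; apply/ffunP => F; rewrite !ffunE frac_inflateK. Qed.

Lemma cech_inflate_cocycle (J J' : set S) j z :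
    (forall f, J f -> J' (phi f)) ->
  cocycle J j z -> cocycle J' j (cech_inflate z).
Proof.
move=> JJ' [zS zJ]; split; first exact: cech_inflate_degree zS.
by rewrite -cech_inflate_diff; apply: cech_inflate_degree zJ.
Qed.

Lemma cech_deflate_cocycle (J J' : set S) j z :
    is_ideal J' -> (forall f, J' f -> J (psi f)) ->
  cocycle J' j z -> cocycle J j (cech_deflate z).
Proof.
move=> idJ' JJ' [zS zJ]; split.
  by apply: cech_deflate_degree zS => //; apply: is_ideal_setT.
by rewrite -cech_deflate_diff; apply: cech_deflate_degree zJ.
Qed.

Lemma cech_deflate_coboundary (J J' : set S) j z :
    is_ideal J' -> (forall f, J' f -> J (psi f)) ->
  coboundary J' j z -> coboundary J j (cech_deflate z).
Proof.
move=> idJ' JJ' [b [bS zb]]; exists (cech_deflate b); split.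
  case: j bS {zb} => [->|j bS]; first exact: cech_deflate0.
  by apply: cech_deflate_degree bS => //; apply: is_ideal_setT.
by rewrite -cech_deflate_diff -cech_deflateB; apply: cech_deflate_degree zb.
Qed.

Lemma deflate_homog (e : nat) (f : S) :
  f \is (e * m).-homog -> psi f \is e.-homog.
Proof.
move=> /dhomogP hf; apply/dhomogP => a; rewrite mcoeff_msupp mcoeff_deflate //.
rewrite -mcoeff_msupp => /hf /=; rewrite mdegMn => /eqP.
by rewrite eqn_pmul2r // => /eqP.
Qed.

Lemma deflate_homog_ndvd (e : nat) (f : S) :
  f \is e.-homog -> ~~ (m %| e)%N -> psi f = 0.
Proof.
move=> /dhomogP hf; apply: contraNeq; rewrite -msupp_eq0.
case E: (msupp _) => [//|a s] _; have : a \in msupp (psi f).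
  by rewrite E inE eqxx.
rewrite mcoeff_msupp mcoeff_deflate // -mcoeff_msupp => /hf /= <-.
by rewrite mdegMn dvdn_mull.
Qed.

Lemma xmon_homog (F : {set 'I_n}) : xmon k F \is #|F|.-homog.
Proof.
rewrite xmonE dhomogX /= mdegE -sum1_card [X in _ == X]big_mkcond /=; apply/eqP.
by apply: eq_bigr => i _; rewrite mnmE; case: (i \in F).
Qed.

(** psi divides degrees by m and kills those not divisible by m. This makes a functional with
    finitely many graded components keep that property after composition with [cech_deflate]. *)
Lemma cech_deflate_homog (d : int) z : cech_homog d z ->
  cech_deflate z = 0 \/ exists2 e, d = e * m%:Z & cech_homog e (cech_deflate z).
Proof.
move=> hz.
(* With denominator x_F^(t m), the degree of the numerator is congruent to [d] modulo [m], for every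
   [F]. *)
have hPsi F : z F = 0 \/ exists (e t : nat) (s : S),
    [/\ s \is e.-homog, Psi (z F) = (psi s)%:F / (xmon k F)%:F ^+ t
      & e%:Z = d + (t * m * #|F|)%N%:Z].
  have [|[e [t [s [hs zs ed]]]]] := hz F; [by left|right].
  exists (e + #|F| * (t * m.-1))%N, t, (s * xmon k F ^+ (t * m.-1)); split.
  - by apply: dhomogM => //; apply: dhomogMn; apply: xmon_homog.
  - by rewrite zs localized_frac_deflateE.
  rewrite PoszD ed -addrA -PoszD; congr (_ + Posz _).
  rewrite [(#|F| * _)%N]mulnC -mulnDl -[X in (X + _)%N]muln1.
  by rewrite -mulnDr add1n prednK.
have [/dvdzP[e de]|nd] := boolP (m%:Z %| d)%Z; [right|left].
  exists e => // F; rewrite ffunE.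
  have [->|[c [t [s [hs -> ec]]]]] := hPsi F; [by left; rewrite raddf0|right].
  have : (m%:Z %| c%:Z)%Z.
    rewrite ec de rpredD ?dvdz_mull //; apply/dvdzP; exists (t * #|F|)%N%:Z.
    by rewrite -PoszM mulnAC.
  rewrite dvdzE /= => /dvdnP[c' cc']; exists c', t, (psi s); split => //.
    by apply: deflate_homog; rewrite -cc'.
  have m0 : m%:Z != 0 by rewrite -lt0n.
  by apply: (mulIf m0); rewrite -PoszM -cc' ec de mulrDl -PoszM mulnAC.
apply/ffunP => F; rewrite !ffunE.
have [->|[c [t [s [hs -> ec]]]]] := hPsi F; first by rewrite raddf0.
rewrite (deflate_homog_ndvd hs) ?tofrac0 ?mul0r //.
apply: contra nd => mc.
have -> : d = c%:Z - (t * m * #|F|)%N%:Z by rewrite ec addrK.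
rewrite rpredB //; last first.
by apply/dvdzP; exists (t * #|F|)%N%:Z; rewrite -PoszM mulnAC.
Qed.

(** A functional [f] for [J] pulls back to [f \o cech_deflate] for [J']. Applying it to phi(s) times
    the inflation of [z] gives f (s z), by linearity over phi and the retraction property. *)
Lemma ann_dual_inflate (J J' : set S) j s :
    is_ideal J -> is_ideal J' ->
    (forall f, J f -> J' (phi f)) -> (forall f, J' f -> J (psi f)) ->
  ann_dual J' j (phi s) -> ann_dual J j s.
Proof.
move=> idJ idJ' JJ' J'J ann_s f [fD fB [N fN]] z zJ.
have df : dual_local_cohomology J' j (f \o cech_deflate).
  split=> [a y y' yJ yJ'|y yB|] /=.
  - rewrite cech_deflateD -(@inflateC k n m) cech_deflate_act.
    by apply: fD; apply: (@cech_deflate_cocycle _ J').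
  - by apply: fB; apply: (@cech_deflate_coboundary _ J').
  (* A nonzero deflation of a cochain of degree [d] has degree d / m, so the bound is scaled by
     [m]. *)
  exists (`|N| * m%:Z) => d y dN yJ /cech_deflate_homog[->|[e de he]].
    by apply: fB; apply: coboundary0.
  apply: (fN e) => //; last exact: (@cech_deflate_cocycle _ J').
  apply: le_lt_trans (ler_norm N) _; move: dN.
  by rewrite de normrM [`|m%:Z|]ger0_norm // ltr_pM2r.
have := ann_s _ df (cech_inflate z) (cech_inflate_cocycle JJ' zJ).
by rewrite /= cech_deflate_act cech_inflateK.
Qed.

Lemma S_depth_set_inflate (r : nat) (J J' : set S) j :
    is_ideal J -> is_ideal J' ->
    (forall f, J f -> J' (phi f)) -> (forall f, J' f -> J (psi f)) ->
  S_depth_set r J j -> S_depth_set r J' j.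
Proof.
move=> idJ idJ' JJ' J'J; apply: (krull_dim_geq_integral (phi := phi)).
- exact: inflate_integral.
- exact: is_ideal_ann_dual.
by move=> s; apply: ann_dual_inflate.
Qed.

End CechSplittingComplex.

(** * Powers of the monomial primes attached to faces *)

Section FacePowers.
Variables (k : fieldType) (n : nat).
Local Notation S := {mpoly k[n]}.
Implicit Types (A B F : {set 'I_n}) (a b : 'X_{1..n}) (f g : S)
  (l : nat).

Definition mdeg_off A a : nat := (\sum_(i | i \notin A) a i)%N.

(* The l-th power of the prime generated by the variables outside A. *)
Definition face_power A (l : nat) : {pred S} :=
  fun f => all (fun a => l <= mdeg_off A a)%N (msupp f).

Definition face_prime A : {pred S} := face_power A 1.

Lemma face_powerP A l f :
  reflect (forall a, a \in msupp f -> l <= mdeg_off A a)%N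
    (f \in face_power A l).
Proof. exact: allP. Qed.

Lemma mdeg_offD A a b : mdeg_off A (a + b)%MM = (mdeg_off A a + mdeg_off A b)%N.
Proof.
by rewrite /mdeg_off -big_split; apply: eq_bigr => i _; rewrite mnmDE.
Qed.

Lemma mdeg_off_muln A a m : mdeg_off A (a *+ m)%MM = (mdeg_off A a * m)%N.
Proof.
by rewrite /mdeg_off big_distrl; apply: eq_bigr => i _; rewrite mulmnE.
Qed.

Lemma face_powerX A l a : ('X_[a] \in face_power A l) = (l <= mdeg_off A a)%N.
Proof. by rewrite unfold_in /face_power msuppX /= andbT. Qed.

Lemma face_powerM A l l' f g :
  f \in face_power A l -> g \in face_power A l' ->
  f * g \in face_power A (l + l').
Proof.
move=> /face_powerP hf /face_powerP hg; apply/face_powerP => a /msuppM_le.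
by move=> /allpairsP[[b c] /= [bf cg ->]]; rewrite mdeg_offD leq_add ?hf ?hg.
Qed.

Lemma face_power0 A f : f \in face_power A 0.
Proof. exact/face_powerP. Qed.

Lemma face_power_ideal A l : is_ideal [set f | f \in face_power A l]%classic.
Proof.
split=> [|h f g /= hf hg] /=; first by apply/face_powerP; rewrite msupp0.
apply/face_powerP => a /msuppD_le; rewrite mem_cat => /orP[]; last first.
  by move: a; apply/face_powerP.
by move: a; apply/face_powerP; apply: (face_powerM (face_power0 A h) hf).
Qed.

(** The quotient map by the prime of [A], with k[x_i, i in A] realized inside S. Its kernel is
    [face_prime A], which is therefore prime. *)
Definition face_restr A f : S :=
  f \mPo [tuple (if i \in A then 'X_i else 0 : S) | i < n].

HB.instance Definition _ A := GRing.RMorphism.copy (face_restr A)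
  (comp_mpoly [tuple (if i \in A then 'X_i else 0 : S) | i < n]).

Lemma face_restrX A a :
  face_restr A 'X_[a] = if mdeg_off A a == 0%N then 'X_[a] else 0.
Proof.
rewrite /face_restr comp_mpolyX sum_nat_eq0.
case: ifPn => [/forall_inP a0|/forall_inPn[i iA ai]].
  rewrite mpolyXE_id; apply: eq_bigr => i _; rewrite tnth_mktuple.
  by case: ifPn => // iA; rewrite (eqP (a0 i iA)) !expr0.
rewrite (bigD1 i) //= tnth_mktuple (negPf iA) expr0n (negPf ai).
by rewrite mul0r.
Qed.

Lemma mcoeff_face_restr A f b :
  (face_restr A f)@_b = if mdeg_off A b == 0%N then f@_b else 0.
Proof.
elim/mpolyind: f => [|c a f _ _ IH].
  by rewrite rmorph0 mcoeff0; case: ifP.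
rewrite rmorphD /= !mcoeffD IH -mul_mpolyC rmorphM /=.
rewrite {1}/face_restr comp_mpolyC face_restrX !mcoeffCM.
have [ab|ab] := eqVneq a b.
  by rewrite ab; case: ifP; rewrite ?mcoeff0 ?mulr0 ?addr0.
case: (mdeg_off A a == 0%N);
  rewrite ?mcoeff0 ?mcoeffX ?(negPf ab) ?mulr0 ?add0r //.
Qed.

Lemma face_primeE A f : (f \in face_prime A) = (face_restr A f == 0).
Proof.
apply/face_powerP/eqP => [h|h a].
  apply/mpolyP => a; rewrite mcoeff_face_restr mcoeff0.
  case: ifPn => // /eqP a0.
  apply/eqP; rewrite mcoeff_eq0; apply/negP => /h.
  by rewrite a0.
rewrite lt0n mcoeff_msupp; apply: contra => a0.
by have := congr1 (mcoeff a) h; rewrite mcoeff_face_restr a0 mcoeff0 => ->.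
Qed.

Lemma prime_ideal_face_prime A : prime_ideal (face_prime A).
Proof.
split; last first.
  by move=> u v; rewrite !face_primeE rmorphM mulf_eq0.
split; rewrite ?face_primeE ?rmorph0 ?rmorph1 ?oner_neq0 //.
by move=> a u v; rewrite !face_primeE rmorphD rmorphM /= => /eqP-> /eqP->;
  rewrite mulr0 addr0.
Qed.

(** One variable outside [A] is split off for each unit of [l]; the remaining monomial is [c]. *)
Lemma monomial_face_power A l a : (l <= mdeg_off A a)%N ->
  exists (c : S) (p : nat -> S),
    (forall j, (j < l)%N -> p j \in face_prime A) /\
    'X_[a] = c * \prod_(j < l) p j.
Proof.
elim: l a => [|l IH] a la.
  by exists 'X_[a], (fun=> 0); split=> //; rewrite big_ord0 mulr1.
have [i iA ai] : exists2 i, i \notin A & (0 < a i)%N.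
  have : mdeg_off A a != 0%N by rewrite -lt0n (leq_trans _ la).
  by rewrite sum_nat_eq0 => /forall_inPn[i iA ai]; exists i; rewrite ?lt0n.
have ea : a = (U_(i) + (a - U_(i)))%MM.
  rewrite addmC submK //; apply/mnm_lepP => j; rewrite mnm1E.
  by case: eqP => // <-.
have Ui : mdeg_off A U_(i)%MM = 1%N.
  rewrite /mdeg_off (bigD1 i) //= mnm1E eqxx big1 // => j /andP[_ ji].
  by rewrite mnm1E eq_sym (negPf ji).
have [|c [p [pP e]]] := IH (a - U_(i))%MM.
  by move: la; rewrite {1}ea mdeg_offD Ui add1n ltnS.
exists c, (fun j => if j is j'.+1 then p j' else 'X_i); split.
  by case=> [_|j]; [rewrite face_powerX Ui | apply: pP].
by rewrite {1}ea mpolyXD e big_ord_recl /= mulrCA.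
Qed.

(** Degrees off [A] add up in products, which gives one direction; conversely each monomial in the
    support of [f] contributes one product of [l] elements of the prime. *)
Lemma ideal_power_face_prime A l f :
  ideal_power (face_prime A) l f <-> f \in face_power A l.
Proof.
split.
  move=> [m [c [p [pA ->]]]].
  apply: (is_ideal_sum (I := [set f | f \in face_power A l]%classic)).
    exact: face_power_ideal.
  move=> i _; apply: is_idealMl; first exact: face_power_ideal.
  rewrite /= -[X in face_power A X]card_ord -sum1_card.
  apply: (big_ind2 (fun g l => g \in face_power A l)) => [|g e h e'|j _].
  - exact: face_power0.
  - exact: face_powerM.
  - exact: pA.
move=> /face_powerP fl.
(* The factorizations are chosen for all exponents at once, with dummy values where the degree is
   too small. *)
have /choice[c /choice[p cp]] : forall a, exists c : S, exists p : nat -> S,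
    (l <= mdeg_off A a)%N -> (forall j, (j < l)%N -> p j \in face_prime A) /\
    'X_[a] = c * \prod_(j < l) p j.
  move=> a; have [la|la] := boolP (l <= mdeg_off A a)%N.
    have [c [p cp]] := monomial_face_power la.
    by exists c, p.
  by exists 0, (fun=> 0).
exists (size (msupp f)), (fun i => f@_(tnth (in_tuple (msupp f)) i) *:
  c (tnth (in_tuple (msupp f)) i)),
  (fun i j => p (tnth (in_tuple (msupp f)) i) j).
split=> [i j|].
  by have [|+ _] := cp (tnth (in_tuple (msupp f)) i); [apply/fl/mem_tnth|apply].
rewrite {1}[f]mpolyE big_tnth; apply: eq_bigr => i _.
have [|_ {1}->] := cp (tnth (in_tuple (msupp f)) i); first exact/fl/mem_tnth.
by rewrite scalerAl.
Qed.

Lemma xmon_face_prime A B : (xmon k B \in face_prime A) = ~~ (B \subset A).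
Proof.
rewrite xmonE face_powerX lt0n sum_nat_eq0; congr (~~ _).
apply/forall_inP/fintype.subsetP => [h i iB|h i iA]; last first.
  rewrite mnmE; apply/eqP; case: (boolP (i \in B)) => // /h.
  by rewrite (negPf iA).
by apply: contraLR iB => /h; rewrite mnmE; case: (i \in B).
Qed.

(** * Associated primes and symbolic powers of the Stanley-Reisner ideal *)

Section Complex.
Variables (D : {set {set 'I_n}}).
Hypothesis D_down : forall A B, A \in D -> B \subset A -> B \in D.
Local Notation I := (stanley_reisner k D).

Lemma stanley_reisner_ideal : is_ideal I.
Proof.
split; first by exists (fun=> 0); rewrite big1 // => A _; rewrite mul0r.
move=> a _ _ [g ->] [h ->]; exists (fun A => a * g A + h A).
rewrite mulr_sumr -big_split; apply: eq_bigr => A _ /=.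
by rewrite mulrDl mulrA.
Qed.

Lemma stanley_reisner_xmon A : A \notin D -> I (xmon k A).
Proof.
move=> AD; exists (fun B => (B == A)%:R); rewrite (bigD1 A) //= eqxx mul1r.
by rewrite big1 ?addr0 // => B /andP[_ /negPf->]; rewrite mul0r.
Qed.

(** The ideal is the intersection of the primes of all faces; the nontrivial inclusion is checked on
    each monomial of [f]. *)
Lemma stanley_reisnerE f :
  I f <-> forall A, A \in D -> f \in face_prime A.
Proof.
split=> [[g ->] A AD|h].
  apply: (is_ideal_sum (I := [set f | f \in face_prime A]%classic)).
    exact: face_power_ideal.
  move=> B BD; apply: is_idealMl; first exact: face_power_ideal.
  by rewrite /= xmon_face_prime; apply: contra BD; apply: D_down.
rewrite [f]mpolyE big_seq; apply: is_ideal_sum => [|a af].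
  exact: stanley_reisner_ideal.
rewrite -mul_mpolyC; apply: is_idealMl; first exact: stanley_reisner_ideal.
(* The support of the monomial is a non-face, since x^a has degree 0 off [B] and so avoids the prime
   of [B]; hence x_B is a generator dividing x^a. *)
pose B := [set i | a i != 0%N].
have aB : mdeg_off B a = 0%N.
  by apply: big1 => i; rewrite inE negbK => /eqP.
have BD : B \notin D by apply/negP => /h/face_powerP/(_ a af); rewrite aB.
rewrite -(@submK _ [multinom (i \in B : nat) | i < n] a); last first.
  by apply/mnm_lepP => i; rewrite mnmE inE; case: (a i).
rewrite mpolyXD -xmonE; apply: is_idealMl; first exact: stanley_reisner_ideal.
exact: stanley_reisner_xmon.
Qed.

(** The annihilator of the class of [f] is the intersection of the primes of the faces [A] whose
    prime omits [f]. Being prime, it contains one of these finitely many primes, and so equals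
    it. *)
Lemma associated_prime_face (P : {pred S}) :
  associated_prime I P -> exists A, P = face_prime A.
Proof.
move=> [prP [f fP]]; have [[P0 P1 PD] PM] := prP.
have memP s : s \in P <-> forall A, A \in D -> s * f \in face_prime A.
  by rewrite fP stanley_reisnerE.
have [A [AD fA sub]] : exists A, [/\ A \in D, f \notin face_prime A
    & forall s, s \in face_prime A -> s \in P].
  apply: contrapT => nex.
  (* Otherwise each such prime has an element [g A] outside [P]; their product lies in all of them,
     hence in [P], against primality. *)
  have /choice[g gP] : forall A, exists s,
      (A \in D) && (f \notin face_prime A) -> s \in face_prime A /\ s \notin P.
    move=> A; apply: contrapT => ns; apply: nex; exists A.
    have [/andP[AD fA]|nA] :=
      boolP ((A \in D) && (f \notin face_prime A)); last first.
      by case: ns; exists 0; rewrite (negPf nA).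
    split=> // s sA; apply: contrapT => /negP sP; apply: ns.
    by exists s => _; split.
  have : \prod_(A in D | f \notin face_prime A) g A \in P.
    apply/memP => B BD; have [fB|fB] := boolP (f \in face_prime B).
      by apply: (is_idealMl _ (face_power_ideal B 1)).
    rewrite (bigD1 B) ?BD //= -mulrA mulrC.
    apply: (is_idealMl _ (face_power_ideal B 1)) => /=.
    by case: (gP B); rewrite ?BD.
  apply/negP; apply: (big_ind (fun x => x \notin P)) => //.
    by move=> x y xP yP; apply/negP => /PM; rewrite (negPf xP) (negPf yP).
  by move=> A /gP[].
exists A; apply/funext => s; apply/idP/idP; last exact: sub.
move=> /memP/(_ A AD); have [_ /(_ s f)] := prime_ideal_face_prime A.
by move=> h /h; rewrite (negPf fA) orbF.
Qed.

(** The witness is x_F: by maximality of [F] it lies in the prime of every face other than [F], and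
    it is outside the prime of [F]. *)
Lemma facet_associated_prime F : facet D F -> associated_prime I (face_prime F).
Proof.
move=> /maxsetP[FD Fmax]; split; first exact: prime_ideal_face_prime.
exists (xmon k F) => s; rewrite stanley_reisnerE; split=> [sF A AD|/(_ F FD)].
  have [FA|FA] := boolP (F \subset A).
    rewrite (Fmax A) // mulrC.
    by apply: (is_idealMl _ (face_power_ideal F 1)).
  by apply: (is_idealMl _ (face_power_ideal A 1)); rewrite /= xmon_face_prime.
have [_ h] := prime_ideal_face_prime F.
by move/h; rewrite xmon_face_prime subxx orbF.
Qed.

(** The same faces occur for every exponent [l], so symbolic powers are compared through degrees of
    monomials alone. *)
Lemma symbolic_powerE l f : symbolic_power I l f <->
  forall A, associated_prime I (face_prime A) -> f \in face_power A l.
Proof.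
split=> [h A /h|h P asP]; first by rewrite ideal_power_face_prime.
have [A eA] := associated_prime_face asP; rewrite eA in asP *.
by apply/ideal_power_face_prime; apply: h.
Qed.

Lemma symbolic_power_ideal l : is_ideal (symbolic_power I l).
Proof.
split=> [|a u v]; rewrite !symbolic_powerE.
  by move=> A _; case: (face_power_ideal A l).
move=> hu hv A asA; have [_ h] := face_power_ideal A l.
exact: (h a u v (hu A asA) (hv A asA)).
Qed.

Lemma symbolic_power_inflate (m l t : nat) f : (0 < m)%N -> (t <= m * l)%N ->
  symbolic_power I l f -> symbolic_power I t (inflate m f).
Proof.
move=> m0 tl; rewrite !symbolic_powerE => h A asA; apply/face_powerP => a.
move=> /(msupp_inflate m0)[b bf ->]; rewrite mdeg_off_muln mulnC.
apply: leq_trans tl _; rewrite leq_pmul2l //.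
by apply/face_powerP: bf; apply: h.
Qed.

(** A monomial x^b of psi(f) comes from x^(m b) in [f], so m (l - 1) < t <= m deg(b), where deg is
    taken off [A]; thus l - 1 < deg(b). *)
Lemma symbolic_power_deflate (m l t : nat) f : (0 < m)%N -> (m * l.-1 < t)%N ->
  symbolic_power I t f -> symbolic_power I l (deflate m f).
Proof.
move=> m0 lt; rewrite !symbolic_powerE => h A asA; apply/face_powerP => a.
rewrite mcoeff_msupp mcoeff_deflate // -mcoeff_msupp.
move/face_powerP: (h A asA) => /[apply]; rewrite mdeg_off_muln mulnC.
move=> /(leq_trans lt); rewrite ltn_pmul2l //.
by case: (l).
Qed.

Lemma S_depth_set_symbolic_power (r m l t j : nat) :
    (m * l.-1 < t <= m * l)%N ->
  S_depth_set r (symbolic_power I l) j -> S_depth_set r (symbolic_power I t) j.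
Proof.
move=> /andP[lt tl]; have m0 : (0 < m)%N.
  by case: (m) tl lt => // /[!leqn0]/eqP->.
apply: (S_depth_set_inflate m0); try exact: symbolic_power_ideal.
- by move=> f; apply: symbolic_power_inflate.
- by move=> f; apply: symbolic_power_deflate.
Qed.

End Complex.
End FacePowers.

(** * Normal forms of fractions with denominator a power of x_F *)

Section LocalizedSum.
Variables (k : fieldType) (n : nat).
Local Notation S := {mpoly k[n]}.
Local Notation Q := {fraction {mpoly k[n]}}.
Local Notation "x %:F" := (@tofrac _ x).
Implicit Types (J : set S) (F G : {set 'I_n}).

Lemma localizedD J F (u v : Q) :
  is_ideal J -> localized J F u -> localized J F v -> localized J F (u + v).
Proof.
move=> idJ [s [t [Js ->]]] [s' [t' [Js' ->]]].
exists (s * xmon k F ^+ t' + s' * xmon k F ^+ t), (t + t')%N; split.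
  by apply: is_idealD => //; rewrite mulrC; apply: is_idealMl.
by rewrite addf_div ?xmonF_neq0 // tofracD !tofracM !tofracXn exprD.
Qed.

(** The positive exponent matches the denominators on which [inverse_coef] is defined. *)
Lemma localizedS J F (u : Q) : is_ideal J -> localized J F u ->
  exists (s : S) (t : nat), J s /\ u = s%:F / (xmon k F ^+ t.+1)%:F.
Proof.
move=> idJ [s [t [Js ->]]]; exists (xmon k F * s), t; split.
  exact: is_idealMl.
rewrite tofracXn exprS tofracM -mulf_div divff ?mul1r //.
by rewrite tofrac_eq0 xmon_neq0.
Qed.

Lemma xmonD1 F i : i \in F -> xmon k F = 'X_i * xmon k (F :\ i).
Proof. by move=> iF; rewrite /xmon (big_setD1 i). Qed.

Lemma localizedD1 J F i (u : Q) : i \in F -> localized J (F :\ i) u ->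
  exists (s : S) (t : nat), J s /\
    u = (s * xmon k (F :\ i) * 'X_i ^+ t.+1)%:F / (xmon k F ^+ t.+1)%:F.
Proof.
move=> iF [s [t [Js ->]]]; exists s, t; split => //.
have Xi0 : ('X_i : S) != 0 by rewrite -msupp_eq0 msuppX.
rewrite (xmonD1 iF) exprMn [('X_i ^+ _) * _]mulrC !tofracM -mulf_div.
rewrite divff ?tofrac_eq0 ?expf_neq0 // mulr1 exprSr tofracM -mulf_div.
by rewrite divff ?tofrac_eq0 ?xmon_neq0 // mulr1 tofracXn.
Qed.

End LocalizedSum.

(* The top local cohomology of k[x_i, i in F] is dual to its canonical module,
   whose generator is the coefficient of the inverse of x_F; this functional
   on the Cech cochains of S / J, evaluated at F, detects every s that is not
   in the prime of F. *)
Section FacetFunctional.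
Variables (k : fieldType) (n : nat) (F : {set 'I_n}).
Local Notation S := {mpoly k[n]}.
Local Notation Q := {fraction {mpoly k[n]}}.
Local Notation "x %:F" := (@tofrac _ x).
Local Notation cech := (cech k n).
Local Notation oneF := [multinom (i \in F : nat) | i < n].

(** The coefficient of 1 / x_F in s / x_F^(t + 1) is that of x_F^t in [s]. *)
Definition inverse_coef : Q -> k :=
  frac_ext 0 (fun t => xmon k F ^+ t.+1) (fun s t => s@_(oneF *+ t)%MM).

Lemma inverse_coefE (s : S) t :
  inverse_coef (s%:F / (xmon k F ^+ t.+1)%:F) = s@_(oneF *+ t)%MM.
Proof.
apply: (@frac_extE S nat k 0 (fun t => xmon k F ^+ t.+1)
  (fun s t => s@_(oneF *+ t)%MM)); last by rewrite expf_neq0 ?xmon_neq0.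
move=> {}s {}t s' t' _ _ e.
rewrite -(mcoeffMX s (oneF *+ t'.+1)) -(mcoeffMX s' (oneF *+ t.+1)).
rewrite -!mpolyXn -xmonE e; congr (_@_ _); apply/mnmP => i.
by rewrite !mnmDE !mulmnE -!mulnDr !addSn addnC.
Qed.

Lemma inverse_coef0 : inverse_coef 0 = 0.
Proof. by have := inverse_coefE 0 0; rewrite tofrac0 mul0r mcoeff0. Qed.

Lemma inverse_coefD (u v : Q) :
    localized [set: S]%classic F u -> localized [set: S]%classic F v ->
  inverse_coef (u + v) = inverse_coef u + inverse_coef v.
Proof.
move=> /localizedS[//|s [t [_ ->]]] /localizedS[//|s' [t' [_ ->]]].
rewrite addf_div ?tofrac_eq0 ?expf_neq0 ?xmon_neq0 // -!tofracM -tofracD.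
rewrite -exprD addSn addnS !inverse_coefE mcoeffD xmonE !mpolyXn.
have -> : (oneF *+ (t + t').+1 = oneF *+ t'.+1 + oneF *+ t)%MM.
  by apply/mnmP => i; rewrite mnmDE !mulmnE -mulnDr addSn addnC.
rewrite mcoeffMX; congr (_ + _).
have -> : (oneF *+ t'.+1 + oneF *+ t = oneF *+ t.+1 + oneF *+ t')%MM.
  by apply/mnmP => i; rewrite !mnmDE !mulmnE -!mulnDr !addSn addnC.
by rewrite mcoeffMX.
Qed.

Lemma inverse_coefZ (a : k) (u : Q) : localized [set: S]%classic F u ->
  inverse_coef ((a%:MP)%:F * u) = a * inverse_coef u.
Proof.
move=> /localizedS[//|s [t [_ ->]]].
by rewrite mulrA -tofracM !inverse_coefE mcoeffCM.
Qed.

(** The monomial x_F^t has degree 0 off [F], so it occurs in no element of the prime of [F]. *)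
Lemma inverse_coef_face_prime (J : set S) (u : Q) :
    is_ideal J -> (forall f, J f -> f \in face_prime F) ->
  localized J F u -> inverse_coef u = 0.
Proof.
move=> idJ JF /localizedS[//|s [t [Js ->]]]; rewrite inverse_coefE.
apply/eqP; rewrite mcoeff_eq0; apply/negP.
move/face_powerP: (JF _ Js) => /[apply]; rewrite mdeg_off_muln.
by rewrite /mdeg_off big1 ?mul0n // => i iF; rewrite mnmE (negPf iF).
Qed.

(** Over the denominator x_F^(t + 1) the numerator is divisible by x_i^(t + 1), whereas x_F^t
    contains only x_i^t. *)
Lemma inverse_coefD1 i (u : Q) : i \in F ->
  localized [set: S]%classic (F :\ i) u ->
  localized [set: S]%classic F u /\ inverse_coef u = 0.
Proof.
move=> iF /(localizedD1 iF)[s [t [_ ->]]]; split.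
  by exists (s * xmon k (F :\ i) * 'X_i ^+ t.+1), t.+1; rewrite tofracXn.
rewrite inverse_coefE mpolyXn mcoeffMXE; case: ifP => // /mnm_lepP/(_ i).
by rewrite !mulmnE mnm1E mnmE eqxx iF !mul1n ltnn.
Qed.

(** A homogeneous fraction with a nonzero coefficient at 1 / x_F has degree [- #|F|]. *)
Lemma inverse_coef_homog (d : int) (z : cech) : #|F|%:Z < `|d| ->
  cech_homog d z -> inverse_coef (z F) = 0.
Proof.
move=> dF /(_ F)[->|[e [t [s [hs -> ed]]]]].
  exact: inverse_coef0.
have -> : s%:F / (xmon k F)%:F ^+ t =
    (s * xmon k F)%:F / (xmon k F ^+ t.+1)%:F.
  rewrite exprSr !tofracM -mulf_div divff ?mulr1 ?tofracXn //.
  by rewrite tofrac_eq0 xmon_neq0.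
rewrite inverse_coefE; apply: contraTeq dF; rewrite -mcoeff_msupp => ms.
have := dhomogM hs (xmon_homog k F) => /dhomogP/(_ _ ms) /=.
have := xmon_homog k F; rewrite xmonE dhomogX /= => /eqP hF.
rewrite mdegMn hF => eF; rewrite -leNgt.
have -> : d = - (#|F|%:Z).
  apply/eqP; rewrite -addr_eq0 -(inj_eq (addIr (t * #|F|)%N%:Z)) add0r.
  by rewrite addrAC -ed -PoszD -eF mulnC.
by rewrite normrN.
Qed.

Variables (D : {set {set 'I_n}}) (J : set S).
Hypothesis facetF : facet D F.
Hypothesis J_ideal : is_ideal J.
Hypothesis JF : forall f, J f -> f \in face_prime F.
Hypothesis xmon_J : forall G, G \notin D -> J (xmon k G).

(** At [F], [z] is the sum of an element of the localization of [J] and of the components of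
    [cech_diff b], whose denominators each miss one variable of x_F; the functional kills both. *)
Lemma inverse_coef_coboundary (z : cech) :
  coboundary J #|F| z -> inverse_coef (z F) = 0.
Proof.
move=> [b [bS zb]].
have : localized J F ((z - cech_diff b) F) by move: (zb F); rewrite eqxx.
have -> : (z - cech_diff b) F = z F - cech_diff b F by rewrite !ffunE.
move=> zbF; rewrite -(subrK (cech_diff b F) (z F)).
have [bF b0] : localized [set: S]%classic F (cech_diff b F) /\
    inverse_coef (cech_diff b F) = 0.
  rewrite ffunE; apply: (big_ind (fun u =>
    localized [set: S]%classic F u /\ inverse_coef u = 0)).
  - split; [exact: localized0 | exact: inverse_coef0].
  - move=> u v [uS u0] [vS v0]; split; first exact: localizedD.
    by rewrite inverse_coefD // u0 v0 addr0.
  move=> i iF; set e := #|_|.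
  have [||bS' b0] := @inverse_coefD1 i (b (F :\ i)) => //.
    have := bS; rewrite (cardsD1 i) iF /= => /(_ (F :\ i)).
    by rewrite eqxx.
  have -> : (-1) ^+ e * b (F :\ i) = (((-1) ^+ e)%:MP : S)%:F * b (F :\ i).
    by rewrite !rmorphXn /= !rmorphN1.
  split; first exact: localizedMl.
  by rewrite inverse_coefZ // b0 mulr0.
have zbS : localized [set: S]%classic F (z F - cech_diff b F).
  by case: zbF => s [t [_ e]]; exists s, t.
rewrite inverse_coefD //.
by rewrite b0 addr0 (inverse_coef_face_prime J_ideal JF).
Qed.

Lemma inverse_coef_dual :
  dual_local_cohomology J #|F| (fun z => inverse_coef (z F)).
Proof.
have cF z : cocycle J #|F| z -> localized [set: S]%classic F (z F).
  by move=> [/(_ F)]; rewrite eqxx.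
split=> [a z z' zJ z'J||].
- rewrite ffunE cech_actE inverse_coefD ?inverse_coefZ //; try exact: cF.
  by apply: localizedMl => //; apply: cF.
- exact: inverse_coef_coboundary.
exists #|F|%:Z => d z dF _; exact: inverse_coef_homog.
Qed.

(** If a monomial x^a of [s] had degree 0 off [F], a cocycle supported at [F] would make the
    functional return the coefficient of x^a in [s]. *)
Lemma ann_dual_facet (s : S) : ann_dual J #|F| s -> s \in face_prime F.
Proof.
move=> ann_s; apply/face_powerP => a; apply: contraTT.
rewrite -leqNgt leqn0 => /eqP aF.
have [FD Fmax] := maxsetP facetF.
(* Any bound on the exponents of [a] would do; it lets x^a divide x_F^t, with quotient x^c. *)
pose t := mdeg a.
have ca : ((oneF *+ t - a) + a = oneF *+ t)%MM.
  apply: submK; apply/mnm_lepP => i; rewrite mulmnE mnmE.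
  have [iF|iF] := boolP (i \in F).
    by rewrite mul1n /t mdegE (bigD1 i) //= leq_addr.
  by move/eqP: aF; rewrite sum_nat_eq0 => /forall_inP/(_ i iF)/eqP->.
set c := (oneF *+ t - a)%MM in ca.
pose w : Q := ('X_[c])%:F / (xmon k F ^+ t.+1)%:F.
pose z : cech := [ffun G => if G == F then w else 0].
have zJ : cocycle J #|F| z.
  split=> G; rewrite ffunE.
    have [->|GF] := eqVneq G F; last by case: ifP => // _; apply: localized0.
    by rewrite eqxx; exists 'X_[c], t.+1; rewrite /w tofracXn.
  case: ifPn => GF; last first.
    rewrite big1 // => i iG; rewrite ffunE.
    case: eqP => [Gi|]; rewrite ?mulr0 //.
    by move: GF; rewrite (cardsD1 i) iG Gi eqxx.
  apply: (big_ind (fun u => localized J G u)) => [|u v|i iG].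
  - exact: localized0.
  - exact: localizedD.
  set e := #|_|; have -> : (-1) ^+ e = ((-1) ^+ e : S)%:F :> Q.
    by rewrite rmorphXn /= rmorphN1.
  apply: localizedMl => //; rewrite ffunE; case: eqP => [Gi|_]; last first.
    exact: localized0.
  (* Here [G] is [F] with [i] added, a non-face as [F] is a facet. So x_G lies in [J], and an extra
     factor x_G above and below puts [w] in the localization of [J]. *)
  exists ('X_[c] * 'X_i ^+ t.+1 * xmon k G), t.+2; split.
    apply: is_idealMl => //; apply: xmon_J; apply/negP => GD.
    by move: iG; rewrite (Fmax _ GD) -Gi ?subsetDl ?inE ?eqxx.
  rewrite /w (xmonD1 k iG) Gi -tofracXn; apply/eqP.
  have Xi0 : ('X_i : S) != 0 by rewrite -msupp_eq0 msuppX.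
  rewrite eqr_div ?tofrac_eq0 ?expf_neq0 ?mulf_neq0 ?xmon_neq0 //.
  rewrite -!tofracM tofrac_eq; apply/eqP.
  have key (x y u : S) p :
      u * (x * y) ^+ p.+1 = u * x ^+ p * (x * y) * y ^+ p.
    rewrite exprSr exprMn -!mulrA; congr (_ * (_ * _)).
    by rewrite mulrCA [y * _]mulrC.
  exact: key.
have := ann_s _ inverse_coef_dual z zJ; rewrite /= cech_actE ffunE eqxx /w.
rewrite mulrA -tofracM inverse_coefE -ca mcoeffMX => /eqP.
by rewrite mcoeff_eq0.
Qed.

End FacetFunctional.

(** * A facet bounds the depth of the first symbolic power *)

Section FacetDepth.
Variables (k : fieldType) (n : nat) (D : {set {set 'I_n}}).
Hypothesis D_down : forall A B : {set 'I_n}, A \in D -> B \subset A -> B \in D.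
Local Notation S := {mpoly k[n]}.
Local Notation I := (stanley_reisner k D).

Lemma symbolic_power1_xmon (G : {set 'I_n}) :
  G \notin D -> symbolic_power I 1 (xmon k G).
Proof.
move=> GD; apply/symbolic_powerE => // A [_ [f fA]]; apply/fA.
rewrite mulrC; apply: is_idealMl; first exact: stanley_reisner_ideal.
exact: stanley_reisner_xmon.
Qed.

Lemma symbolic_power1_facet (F : {set 'I_n}) f :
  facet D F -> symbolic_power I 1 f -> f \in face_prime F.
Proof.
by move=> facetF /symbolic_powerE; apply => //; apply: facet_associated_prime.
Qed.

Lemma face_primeS (A B : {set 'I_n}) :
  B \subset A -> {subset face_prime (k := k) A <= face_prime B}.
Proof.
move=> /fintype.subsetP BA f /face_powerP fA; apply/face_powerP => a /fA.
rewrite !lt0n; apply: contra; rewrite !sum_nat_eq0 => /forall_inP h.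
by apply/forall_inP => i iA; apply: h; apply: contra iA; apply: BA.
Qed.

(** Removing the vertices of [F] one by one gives a chain of face primes from that of [F] up to that
    of the empty set; each step gains the variable of the removed vertex. *)
Lemma krull_dim_face_prime (J : set S) (F : {set 'I_n}) (e : int) :
    (forall f, J f -> f \in face_prime F) -> e <= #|F|%:Z ->
  krull_dim_geq J e.
Proof.
move=> JF eF; pose A i : {set 'I_n} := [set x | x \in drop i (enum F)].
exists #|F|, (fun i => face_prime (A i)); split => //.
- by move=> i _; apply: prime_ideal_face_prime.
- move=> f /JF; rewrite (_ : A 0%N = F) //.
  by apply/setP => x; rewrite inE drop0 mem_enum.
move=> i iF.
have [x0 _] : exists x0, x0 \in F by apply/card_gt0P; apply: leq_trans iF.
have i_enum : (i < size (enum F))%N by rewrite -cardE.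
have dropE := drop_nth x0 i_enum.
split=> [|sub]; first apply: face_primeS.
  by apply/fintype.subsetP => x; rewrite !inE dropE inE orbC => ->.
have := sub 'X_(nth x0 (enum F) i).
rewrite !face_powerX !lt0n !sum_nat_eq0 => h.
have /h/forall_inPn[j jA] : ~~ [forall (j | j \notin A i.+1),
    U_(nth x0 (enum F) i)%MM j == 0%N].
  apply/forall_inPn; exists (nth x0 (enum F) i); last by rewrite mnm1E eqxx.
  rewrite unfold_in inE; have := drop_uniq i (enum_uniq F).
  by rewrite dropE /= => /andP[].
rewrite mnm1E; case: (nth x0 (enum F) i =P j) => // ej _.
by move: jA; rewrite unfold_in -ej inE dropE inE eqxx.
Qed.

Lemma S_depth_set_facet (r : nat) (F : {set 'I_n}) :
  (0 < r)%N -> facet D F -> S_depth_set r (symbolic_power I 1) #|F|.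
Proof.
move=> r0 facetF; apply: (@krull_dim_face_prime _ F).
  move=> f; apply: (ann_dual_facet facetF).
  - exact: symbolic_power_ideal.
  - by move=> g; apply: symbolic_power1_facet.
  - exact: symbolic_power1_xmon.
by rewrite -addrA gerDl addrC subr_le0 lez_nat.
Qed.

End FacetDepth.

(** * Depth as a genuine minimum, and convergence *)

Lemma S_depthP (k : fieldType) (n r : nat) (J : set {mpoly k[n]}) :
    (exists j, S_depth_set r J j) ->
  S_depth_set r J (S_depth r J) /\
  forall j, S_depth_set r J j -> (S_depth r J <= j)%N.
Proof.
move=> exJ; rewrite /S_depth; case: pselect => [ex|[]]; last first.
  by case: exJ => j Jj; exists j; apply/asboolP.
case: ex_minnP => j /asboolP Jj jmin; split=> // i Ji.
by apply: jmin; apply/asboolP.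
Qed.

Lemma exists_multiplier (l t : nat) : (0 < l)%N -> (l * l <= t)%N ->
  exists m : nat, (m * l.-1 < t <= m * l)%N.
Proof.
move=> l0 lt; exists (t %/ l).+1; rewrite (ltnW (ltn_ceil _ l0)) andbT.
have lq : (l <= t %/ l)%N by rewrite leq_divRL.
apply: leq_trans (leq_divM t l).
case: l l0 lq {lt} => // l _ lq /=.
by rewrite mulSn mulnS ltn_add2r.
Qed.

Theorem theorem1p9 (k : fieldType) (n : nat) (D : {set {set 'I_n}})
    (D_complex : simplicial_complex D) (D_pure : pure D) :
  let sdepth : nat -> nat :=
    fun l => S_depth 2 (symbolic_power (stanley_reisner k D) l) in
  cvg (sdepth @ \oo)%classic /\
  is_min [set sdepth l | l in [set l | (1 <= l)%N]]%classic
    (lim (sdepth @ \oo)%classic).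
Proof.
move=> sdepth; have [D0 D_down] := D_complex.
have [F facetF] : exists F, facet D F.
  have [A AD] := set0Pn _ D0.
  by have [F FD _] := maxset_exists (P := fun A => A \in D) AD; exists F.
pose J l := symbolic_power (stanley_reisner k D) l.
have exJ l : (0 < l)%N -> exists j, S_depth_set 2 (J l) j.
  move=> l0; exists #|F|.
  apply: (S_depth_set_symbolic_power D_down (m := l) (l := 1)).
    by rewrite muln0 muln1 l0 /=.
  exact: S_depth_set_facet.
have sdepth_le l t : (0 < l)%N -> (l * l <= t)%N -> (sdepth t <= sdepth l)%N.
  move=> l0 lt; have t0 : (0 < t)%N by apply: leq_trans lt; rewrite muln_gt0 l0.
  have [_] := S_depthP (exJ t t0); apply.
  have [m mlt] := exists_multiplier l0 lt.
  apply: (S_depth_set_symbolic_power D_down mlt).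
  by case: (S_depthP (exJ l l0)).
have ex_value : exists v, `[< exists2 l, (0 < l)%N & sdepth l = v >].
  by exists (sdepth 1%N); apply/asboolP; exists 1%N.
have [v /asboolP[l l0 lv] vmin] := ex_minnP ex_value.
have near_v : (\forall t \near \oo, sdepth t = v)%classic.
  exists (l * l)%N => // t /= lt; apply/eqP; rewrite eqn_leq.
  rewrite -{1}lv sdepth_le //=; apply: vmin; apply/asboolP; exists t => //.
  by apply: leq_trans lt; rewrite muln_gt0 l0.
have lim_v : (lim (sdepth @ \oo) = v)%classic.
  by apply: lim_near_cst near_v; apply: discrete_hausdorff.
split; first exact: is_cvg_near_cst near_v.
rewrite lim_v; split; first by exists l.
by move=> _ [t /= t0 <-]; apply: vmin; apply/asboolP; exists t.
Qed.
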